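(* The class of normal posets is not axiomatizable by first-order sentences in the signature $\{\leq\}$.
   Context: A binary operation $\cdot$ on a poset $(P,\leq)$ is admissible if for all $x,y\in P$: $x\leq y\iff x\cdot y=x$. A right-normal band is a set with an associative binary operation satisfying $x\cdot x=x$ and $x\cdot y\cdot z=y\cdot x\cdot z$. A poset is normal if it admits an admissible right-normal band operation. *)

(* Defs.v *)
From Stdlib Require Import Relation_Definitions.
From mathcomp Require Import ssreflect ssrfun ssrbool eqtype ssrnat fintype.

Set Implicit Arguments.
Unset Strict Implicit.
Unset Printing Implicit Defensive.

(* [formula n] is the type of first-order formulas with equality in the
   signature {<=} whose free variables are among 'I_n; a quantifier binds
   variable 0 of its body, and variable [i] outside it is [lift ord0 i] inside. *)
Inductive formula : nat -> Type :=
| FBot n : formula n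
| FEq  n (i j : 'I_n) : formula n
| FLe  n (i j : 'I_n) : formula n
| FImp n (f g : formula n) : formula n
| FAnd n (f g : formula n) : formula n
| FOr  n (f g : formula n) : formula n
| FAll n (f : formula n.+1) : formula n
| FEx  n (f : formula n.+1) : formula n.

Definition sentence : Type := formula 0.

(* As usual in first-order logic, carriers are nonempty; no order axiom is
   imposed on the interpretation of the symbol <=. *)
Record structure : Type := Structure {
  carrier :> Type;
  le : relation carrier;
  carrier_inhabited : inhabited carrier
}.

Definition env_cons (A : Type) n (a : A) (e : 'I_n -> A) : 'I_n.+1 -> A :=
  fun i => oapp e a (unlift ord0 i).

Fixpoint sat (M : structure) n (f : formula n) : ('I_n -> M) -> Prop :=
  match f in formula k return ('I_k -> M) -> Prop with
  | FBot _     => fun _ => False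
  | FEq _ i j  => fun e => e i = e j
  | FLe _ i j  => fun e => le (e i) (e j)
  | FImp _ g h => fun e => sat g e -> sat h e
  | FAnd _ g h => fun e => sat g e /\ sat h e
  | FOr _ g h  => fun e => sat g e \/ sat h e
  | FAll _ g   => fun e => forall a : M, sat g (env_cons a e)
  | FEx _ g    => fun e => exists a : M, sat g (env_cons a e)
  end.

Definition empty_env (A : Type) (i : 'I_0) : A :=
  False_rect A (not_false_is_true (ltn_ord i)).

Definition models (M : structure) (T : sentence -> Prop) : Prop :=
  forall f : sentence, T f -> sat f (@empty_env M).

Definition axiomatizable (K : structure -> Prop) : Prop :=
  exists T : sentence -> Prop, forall M : structure, K M <-> models M T.

Definition is_poset (M : structure) : Prop :=
  Relation_Definitions.order M (@le M).

Definition right_normal_band (A : Type) (op : A -> A -> A) : Prop :=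
  [/\ associative op,
      forall x, op x x = x
    & forall x y z, op (op x y) z = op (op y x) z].

Definition admissible (A : Type) (leA : relation A) (op : A -> A -> A) : Prop :=
  forall x y, leA x y <-> op x y = x.

Definition normal_poset (M : structure) : Prop :=
  is_poset M /\
  exists op : M -> M -> M, right_normal_band op /\ admissible (@le M) op.

(* Main.v *)
(** The disjoint union of two copies of the chain of rationals is a normal
    poset, and by an Ehrenfeucht-Fraisse back-and-forth argument it is
    elementarily equivalent to the disjoint union of the rationals and the
    reals. The latter is not normal: for a rational [x] and a real [y], right
    multiplication by [x y] maps the down-set of [y x] in the rationals onto the
    down-set of [x y] in the reals, which is uncountable. *)
Require Import Defs.
From mathcomp Require Import all_boot all_order all_algebra lra.
From mathcomp Require Import classical_sets reals Rstruct.
Import Order.TTheory GRing.Theory Num.Theory.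

Set Implicit Arguments.
Unset Strict Implicit.
Unset Printing Implicit Defensive.

Local Open Scope ring_scope.

Lemma env_cons0 (A : Type) n (a : A) (e : 'I_n -> A) : env_cons a e ord0 = a.
Proof. by rewrite /env_cons unlift_none. Qed.

Lemma env_cons_lift (A : Type) n (a : A) (e : 'I_n -> A) i :
  env_cons a e (lift ord0 i) = e i.
Proof. by rewrite /env_cons liftK. Qed.

(** [E] relates assignments of every length [n], since a quantifier lengthens them by one. In the
    induction on [f], [E_eq] and [E_le] settle the atoms, while [forth] and [back] carry the witness
    of a quantifier from one structure to the other. *)
Lemma back_and_forth (M N : structure)
    (E : forall n, ('I_n -> M) -> ('I_n -> N) -> Prop)
    (E_eq : forall n (e : 'I_n -> M) e', E n e e' ->
      forall i j, e i = e j <-> e' i = e' j)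
    (E_le : forall n (e : 'I_n -> M) e', E n e e' ->
      forall i j, le (e i) (e j) <-> le (e' i) (e' j))
    (forth : forall n (e : 'I_n -> M) e', E n e e' ->
      forall a, exists b, E n.+1 (env_cons a e) (env_cons b e'))
    (back : forall n (e : 'I_n -> M) e', E n e e' ->
      forall b, exists a, E n.+1 (env_cons a e) (env_cons b e'))
    n (f : formula n) (e : 'I_n -> M) (e' : 'I_n -> N) :
  E n e e' -> sat f e <-> sat f e'.
Proof.
elim: f e e' => {n}
  [n|n i j|n i j|n g IHg h IHh|n g IHg h IHh|n g IHg h IHh|n g IHg|n g IHg]
  e e' Ee /=.
- by [].
- exact: E_eq.
- exact: E_le.
- by have := IHg _ _ Ee; have := IHh _ _ Ee; tauto.
- by have := IHg _ _ Ee; have := IHh _ _ Ee; tauto.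
- by have := IHg _ _ Ee; have := IHh _ _ Ee; tauto.
- split=> H.
  + by move=> b; have [a /IHg <-] := back _ _ _ Ee b.
  + by move=> a; have [b /IHg ->] := forth _ _ _ Ee a.
- split=> -[].
  + by move=> a ga; have [b /IHg Eab] := forth _ _ _ Ee a; exists b; apply/Eab.
  + by move=> b gb; have [a /IHg Eab] := back _ _ _ Ee b; exists a; apply/Eab.
Qed.

Lemma seq_separation (F : realFieldType) (L U : seq F) :
  (forall l u, l \in L -> u \in U -> l < u) ->
  exists y, (forall l, l \in L -> l < y) /\ (forall u, u \in U -> y < u).
Proof.
elim: L => [|l L IH] LU.
  elim: U {LU} => [|u U [y [_ yU]]]; first by exists 0.
  exists (Num.min y (u - 1)); split=> // v; rewrite inE => /predU1P[->|/yU yv].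
    by rewrite gt_min gtrBl ltr01 orbT.
  by rewrite gt_min yv.
have [|y [Ly yU]] := IH.
  by move=> k u kL uU; apply: LU => //; rewrite inE kL orbT.
(* If [y <= l], then [l] exceeds the rest of [L], so any point strictly between [l] and [U] will
   do. *)
have [ly|yl] := ltP l y.
  by exists y; split=> // k; rewrite inE => /predU1P[->//|/Ly].
have lU u : u \in U -> l < u by apply: LU; rewrite mem_head.
have [z [lz zU]] : exists z, l < z /\ forall u, u \in U -> z < u.
  elim: U lU {LU IH yU} => [|u U IH] lU.
    by exists (l + 1); split=> //; lra.
  have [|z [lz zU]] := IH; first by move=> v vU; apply: lU; rewrite inE vU orbT.
  have lu : l < u by apply: lU; rewrite mem_head.
  exists (Num.min z ((l + u) / 2)); split; first by rewrite lt_min lz /=; lra.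
  move=> v; rewrite inE gt_min => /predU1P[->|/zU ->//].
  by apply/orP; right; lra.
exists z; split=> // k; rewrite inE => /predU1P[->//|/Ly ky].
exact: lt_trans ky (le_lt_trans yl lz).
Qed.

(** One-point extension of a finite partial isomorphism: if [x] is some [u i], take [v i]; otherwise
    separate the images of the points below [x] from those of the points above it. [P] will select
    the entries lying in one summand. *)
Lemma order_extension (F F' : realFieldType) (I : finType) (P : pred I)
    (u : I -> F) (v : I -> F') (x : F) :
  (forall i j, P i -> P j -> (u i <= u j) = (v i <= v j)) ->
  exists y, forall i, P i -> (x <= u i) = (y <= v i) /\ (u i <= x) = (v i <= y).
Proof.
move=> uv; have [/existsP[i /andP[Pi /eqP <-]]|/existsPn nx] :=
  boolP [exists i, P i && (u i == x)].
  by exists (v i) => j Pj; rewrite !uv.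
have [|y [Ly yU]] := @seq_separation F'
    [seq v i | i in [pred i | P i && (u i < x)]]
    [seq v i | i in [pred i | P i && (x < u i)]].
  move=> l r /fintype.imageP[i iL ->] /fintype.imageP[j jU ->].
  move: iL jU; rewrite !inE => /andP[Pi ix] /andP[Pj xj].
  by rewrite ltNge -uv // -ltNge (lt_trans ix xj).
exists y => i Pi; have := nx i; rewrite Pi /=; case: (ltgtP (u i) x) => // ix _.
- have : v i < y by apply: Ly; apply: fintype.image_f; rewrite inE Pi.
  by case: ltgtP.
- have : y < v i by apply: yU; apply: fintype.image_f; rewrite inE Pi.
  by case: ltgtP.
Qed.

Definition sum_le (F G : realFieldType) (p q : F + G) : bool :=
  match p, q with
  | inl x, inl y => x <= y
  | inr x, inr y => x <= y
  | _, _ => false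
  end.

Definition sum_chain (F G : realFieldType) : structure :=
  Structure (fun p q : F + G => sum_le p q) (inhabits (inl 0)).

Lemma sum_le_refl (F G : realFieldType) (p : F + G) : sum_le p p.
Proof. by case: p => x /=. Qed.

Lemma sum_le_anti (F G : realFieldType) (p q : F + G) :
  sum_le p q -> sum_le q p -> p = q.
Proof.
by case: p q => x [] y //= xy yx; congr (_ _); apply/le_anti; rewrite xy yx.
Qed.

Lemma sum_chain_poset (F G : realFieldType) : is_poset (sum_chain F G).
Proof.
split=> [p|p q r|p q]; first exact: sum_le_refl; last exact: sum_le_anti.
by case: p q r => x [] y [] z //=; apply: le_trans.
Qed.

Definition is_inl (A B : Type) (p : A + B) : bool :=
  if p is inl _ then true else false.

(** The summand of each entry is recorded because it decides on which side a new point is placed.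
    Equality of entries is recovered from [sum_le] by antisymmetry. *)
Definition sum_match (F G F' G' : realFieldType) n
    (e : 'I_n -> sum_chain F G) (e' : 'I_n -> sum_chain F' G') : Prop :=
  (forall i, is_inl (e i) = is_inl (e' i)) /\
  (forall i j, sum_le (e i) (e j) = sum_le (e' i) (e' j)).

Lemma sum_match_sym (F G F' G' : realFieldType) n
    (e : 'I_n -> sum_chain F G) (e' : 'I_n -> sum_chain F' G') :
  sum_match e e' -> sum_match e' e.
Proof. by case=> es el; split=> *; rewrite (es, el). Qed.

Lemma sum_match_forth (F G F' G' : realFieldType) n
    (e : 'I_n -> sum_chain F G) (e' : 'I_n -> sum_chain F' G') a :
  sum_match e e' -> exists b, sum_match (env_cons a e) (env_cons b e').
Proof.
case=> es el.
suff [b [ab b_ext]] : exists b : sum_chain F' G', is_inl a = is_inl b /\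
    forall i, sum_le a (e i) = sum_le b (e' i) /\
              sum_le (e i) a = sum_le (e' i) b.
  exists b; split=> [i|i j].
    by case: (unliftP ord0 i) => [k|] ->; rewrite !(env_cons0, env_cons_lift).
  case: (unliftP ord0 i) => [k|] ->; case: (unliftP ord0 j) => [l|] ->;
    rewrite !(env_cons0, env_cons_lift) ?sum_le_refl //;
    by [case: (b_ext k) | case: (b_ext l)].
case: a => x.
(* The value 0 at entries of the other summand is a dummy: the predicate excludes them, and they are
   incomparable with the new point in both structures. *)
- have [i j|y xy] := @order_extension F F' 'I_n (fun i => is_inl (e i))
    (fun i => if e i is inl z then z else 0)
    (fun i => if e' i is inl z then z else 0) x.
    by have := el i j; have := es i; have := es j;
      case: (e i) (e j) (e' i) (e' j) => ? [] ? [] ? [] ?.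
  exists (inl y); split=> // i; have := xy i; have := es i.
  by case: (e i) (e' i) => z [] z' //= _ /(_ isT).
- have [i j|y xy] := @order_extension G G' 'I_n (fun i => ~~ is_inl (e i))
    (fun i => if e i is inr z then z else 0)
    (fun i => if e' i is inr z then z else 0) x.
    by have := el i j; have := es i; have := es j;
      case: (e i) (e j) (e' i) (e' j) => ? [] ? [] ? [] ?.
  exists (inr y); split=> // i; have := xy i; have := es i.
  by case: (e i) (e' i) => z [] z' //= _ /(_ isT).
Qed.

Lemma sum_chain_elementary_equiv (F G F' G' : realFieldType) (f : sentence) :
  sat f (@empty_env (sum_chain F G)) <-> sat f (@empty_env (sum_chain F' G')).
Proof.
apply: (@back_and_forth _ _ (@sum_match F G F' G')); last by split=> -[].
- move=> n e e' [_ el] i j.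
  by split=> eij; apply: sum_le_anti; rewrite (el, =^~ el) eij sum_le_refl.
- by move=> n e e' [_ el] i j /=; rewrite el.
- by move=> n e e' ee' a; apply: sum_match_forth.
- move=> n e e' /sum_match_sym ee' b.
  by have [a /sum_match_sym] := sum_match_forth b ee'; exists a.
Qed.

Lemma sum_chain_same_normal (F : realFieldType) : normal_poset (sum_chain F F).
Proof.
split; first exact: sum_chain_poset.
(* Both summands being the same chain, values can be compared across them: the product is the
   minimum of the values, placed in the summand of the right factor. *)
pose v (p : F + F) := match p with inl x | inr x => x end.
exists (fun p q : F + F => match q with
  | inl y => inl (Num.min (v p) y) | inr y => inr (Num.min (v p) y) end).
split; first split.
- by move=> p q [] z; case: q => y /=; rewrite minA.
- by case=> x /=; rewrite minxx.
- by move=> p q [] z; case: p => x; case: q => y /=; rewrite [Num.min x y]minC.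
- by move=> [] x [] y /=; split=> //= => [/min_idPl -> //|[/min_idPl]].
Qed.

(* Left endpoint of the [n]-th nested interval, of length [(b - a) / 3 ^ n],
   chosen so that the interval avoids [u 0], ..., [u n.-1]. *)
Fixpoint avoiding_left (R : realType) (u : nat -> R) (a b : R) n : R :=
  if n is m.+1 then
    let l := (b - a) / 3 ^+ m in let c := avoiding_left u a b m in
    if u m <= c + l / 2 then c + l * (2 / 3) else c
  else a.

(** Cantor's nested intervals: the supremum of the left endpoints [c n] lies in every interval
    [[c n, d n]]. *)
Lemma itv_uncountable (R : realType) (u : nat -> R) (a b : R) :
  a < b -> exists x, a <= x <= b /\ forall n, u n <> x.
Proof.
move=> ab; pose c := avoiding_left u a b; pose d n := c n + (b - a) / 3 ^+ n.
have l_gt0 n : 0 < (b - a) / 3 ^+ n by rewrite divr_gt0 ?subr_gt0 ?exprn_gt0.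
have lS n : (b - a) / 3 ^+ n.+1 = (b - a) / 3 ^+ n / 3.
  by rewrite exprSr invfM mulrA.
have cS n : c n <= c n.+1 by rewrite /c /=; have := l_gt0 n; case: ifP; lra.
have dS n : d n.+1 <= d n.
  by rewrite /d lS /c /=; have := l_gt0 n; case: ifP; lra.
have c_mono : {homo c : m n / (m <= n)%N >-> m <= n}.
  by apply: homo_leq => //; apply: le_trans.
have d_mono : {homo d : m n / (m <= n)%N >-> n <= m}.
  by apply: homo_leq => // y x z xy yz; apply: le_trans yz xy.
have cd m n : c m <= d n.
  apply: (@le_trans _ _ (c (maxn m n))); first by rewrite c_mono ?leq_maxl.
  apply: (@le_trans _ _ (d (maxn m n))); last by rewrite d_mono ?leq_maxr.
  by rewrite /d lerDl ltW.
have cne : (range c !=set0)%classic by exists (c 0); exists 0.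
have c_sup n : c n <= sup (range c).
  apply: ub_le_sup; last by exists n.
  by exists (d 0) => _ [m _ <-].
have sup_d n : sup (range c) <= d n.
  by apply: ge_sup => // _ [m _ <-].
exists (sup (range c)); split.
  by rewrite (c_sup 0) (le_trans (sup_d 0)) // /d /c /= expr0; lra.
(* Interval [n.+1] is the last third of interval [n] if [u n] is at most the midpoint, and the first
   third otherwise; either way it misses [u n]. *)
move=> n; have := c_sup n.+1; have := sup_d n.+1.
rewrite /d lS; have := l_gt0 n; rewrite /c /=; case: (lerP (u n)); lra.
Qed.

Lemma sum_chain_rat_real_not_normal (R : realType) :
  ~ normal_poset (sum_chain rat R).
Proof.
case=> _ [op [[opA opI opN] adm]].
pose x : sum_chain rat R := inl 0; pose y : sum_chain rat R := inr 0.
(* As [(x y) y = x y], the product is below [y], hence in the summand of [y]. *)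
have [b xyE] : exists b, op x y = inr b.
  have /adm : op (op x y) y = op x y by rewrite -opA opI.
  by case: (op x y) => // b; exists b.
have [a yxE] : exists a, op y x = inl a.
  have /adm : op (op y x) x = op y x by rewrite -opA opI.
  by case: (op y x) => // a; exists a.
have yxxy : op (op y x) (op x y) = op x y.
  by rewrite opA -[op (op y x) x]opA opI opN -opA opI.
(* [u] enumerates the real products [q (x y)] over all rationals [q]; the default 0 only adds one
   more value for [w] to avoid. *)
pose u n : R := if unpickle n is Some q then
  if op (inl q) (op x y) is inr r then r else 0 else 0.
have [|w [/andP[_ wb] uw]] := @itv_uncountable _ u (b - 1) b; first by lra.
have /adm w_xy : le (inr w : sum_chain rat R) (op x y) by rewrite xyE.
(* [w (y x)] is below [y x], so it is a rational [q], and [q (x y) = w (y x) (x y) = w (x y) = w]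
   puts [w] in the enumeration. *)
have /adm : op (op (inr w) (op y x)) (op y x) = op (inr w) (op y x).
  by rewrite -opA opI.
rewrite {2}yxE; case wyxE: (op (inr w) (op y x)) => [q|//] _.
by apply: (uw (pickle q)); rewrite /u pickleK -wyxE -opA yxxy w_xy.
Qed.

Theorem theorem4p4 : ~ axiomatizable normal_poset.
Proof.
case=> T axT; apply: (@sum_chain_rat_real_not_normal Rdefinitions.R).
apply/axT => f Tf; apply/(@sum_chain_elementary_equiv rat rat).
by move: f Tf; apply/axT; apply: sum_chain_same_normal.
Qed.
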